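(* Let $X$ be a nonempty closed convex subset of a real Hilbert space $H$ and let $F:X\to H$ be monotone on $X$. Let $X^*$ be the solution set of the variational inequality problem for $(F,X)$; assume $X^*$ is nonempty, closed and convex, and weakly sharp (with some modulus). Let $\{x_k\}$ be a sequence in $X$. Then $x_k\in X^*$ for all sufficiently large $k$ if and only if $$\lim_{k\to\infty}P_{T_X(x_k)}\big(-F(x_k)\big)=0.$$
   Context: $H$ is a real Hilbert space with inner product $\langle\cdot,\cdot\rangle$, norm $\|\cdot\|$ and closed unit ball $\mathbb{B}$; the limit is in norm. The solution set is $X^*=\{x^*\in X : \langle F(x^* ),x-x^*\rangle\ge 0 \text{ for all } x\in X\}$. $F$ is monotone on $X$ if $\langle F(x)-F(y),x-y\rangle\ge 0$ for all $x,y\in X$. $P_C(x)$ is the unique point of a nonempty closed convex set $C$ nearest to $x$. The polar of $C\subseteq H$ is $C^\circ=\{u\in H:\langle u,x\rangle\le 0\ \text{for all } x\in C\}$. For a closed convex set $C$ and $x\in C$, the tangent cone is $T_C(x)=\mathrm{cl}\big(\bigcup_{\lambda>0}\frac{C-x}{\lambda}\big)$ and the normal cone is $N_C(x)=[T_C(x)]^\circ$. $X^*$ is called weakly sharp if $-F(x^* )\in\mathrm{int}\Big(\bigcap_{x\in X^*}\big[T_X(x)\cap N_{X^*}(x)\big]^\circ\Big)$ for all $x^*\in X^*$. $X^*$ is weakly sharp with modulus $\alpha>0$ if it is weakly sharp and $\alpha\mathbb{B}\subset F(x^* )+[T_X(x^* )\cap N_{X^*}(x^* )]^\circ$ for every $x^*\in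 X^*$; equivalently (for this last inclusion) $\langle F(x^* ),v\rangle\ge\alpha\|v\|$ for all $x^*\in X^*$ and all $v\in T_X(x^* )\cap N_{X^*}(x^* )$. ''Weakly sharp with some modulus'' means weakly sharp with modulus $\alpha$ for some $\alpha>0$ (the same for all $x^*\in X^*$). *)

(* Defs.v *)
From mathcomp Require Import all_boot all_order all_algebra.
From mathcomp Require Import sesquilinear.
From mathcomp Require Import all_classical all_reals all_analysis.
Set Implicit Arguments.
Unset Strict Implicit.
Unset Printing Implicit Defensive.
Import Order.TTheory GRing.Theory Num.Theory.
Import numFieldNormedType.Exports.
Local Open Scope classical_set_scope.
Local Open Scope ring_scope.

(* A real Hilbert space is a complete normed module [H] over the reals with an
   inner product [ip : {dot H for idfun}] (a positive definite symmetric
   bilinear form) inducing the norm. *)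
Definition induces_norm (R : realType) (H : normedModType R)
    (ip : {dot H for idfun}) : Prop :=
  forall u : H, ip u u = `|u| ^+ 2.

(* A map [F : X -> H] is represented by a total function of which only the
   values on [X] are ever used. *)
Definition monotone_on (R : realType) (H : normedModType R)
    (ip : {dot H for idfun}) (X : set H) (F : H -> H) : Prop :=
  forall x y, X x -> X y -> 0 <= ip (F x - F y) (x - y).

Definition VI_sol (R : realType) (H : normedModType R)
    (ip : {dot H for idfun}) (X : set H) (F : H -> H) : set H :=
  [set xs | X xs /\ forall x, X x -> 0 <= ip (F xs) (x - xs)].

(* The set of points of [C] nearest to [x] is a singleton when [C] is nonempty,
   closed and convex in a Hilbert space; [metric_proj C x] is then its element. *)
Definition metric_proj (R : realType) (H : normedModType R) (C : set H) (x : H) : H :=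
  get [set p | C p /\ forall y, C y -> `|x - p| <= `|x - y|].

Definition polar (R : realType) (H : normedModType R)
    (ip : {dot H for idfun}) (C : set H) : set H :=
  [set u | forall x, C x -> ip u x <= 0].

Definition tangent_cone (R : realType) (H : normedModType R)
    (C : set H) (x : H) : set H :=
  closure (\bigcup_(l in [set l : R | 0 < l]) [set l^-1 *: (y - x) | y in C]).

Definition normal_cone (R : realType) (H : normedModType R)
    (ip : {dot H for idfun}) (C : set H) (x : H) : set H :=
  polar ip (tangent_cone C x).

(* [T_X(x) `&` N_{X*}(x)]^o, where [X*] is the solution set. *)
Definition sharp_polar (R : realType) (H : normedModType R)
    (ip : {dot H for idfun}) (X : set H) (F : H -> H) (x : H) : set H :=
  polar ip (tangent_cone X x `&` normal_cone ip (VI_sol ip X F) x).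

Definition weakly_sharp (R : realType) (H : normedModType R)
    (ip : {dot H for idfun}) (X : set H) (F : H -> H) : Prop :=
  forall xs, VI_sol ip X F xs ->
    interior (\bigcap_(x in VI_sol ip X F) sharp_polar ip X F x) (- F xs).

Definition weakly_sharp_modulus (R : realType) (H : normedModType R)
    (ip : {dot H for idfun}) (X : set H) (F : H -> H) (alpha : R) : Prop :=
  weakly_sharp ip X F /\
  forall xs, VI_sol ip X F xs ->
    [set alpha *: b | b in closed_ball (0 : H) 1] `<=`
    [set F xs + w | w in sharp_polar ip X F xs].

(* Main.v *)
Require Import Defs.
From mathcomp Require Import all_boot all_order all_algebra sesquilinear.
From mathcomp Require Import all_classical all_reals all_analysis.
From mathcomp Require Import ring lra.
Set Implicit Arguments.
Unset Strict Implicit.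
Unset Printing Implicit Defensive.
Import Order.TTheory GRing.Theory Num.Theory.
Import numFieldNormedType.Exports.
Local Open Scope classical_set_scope.
Local Open Scope ring_scope.

(** If [x k] solves the inequality then [- F (x k)] is polar to the tangent
    cone of [X] at [x k], so its projection on that cone is [0]
    ([metric_proj_polar]).

    For the converse, suppose that [x] in [X] is not a solution.  Let [y] be
    the solution nearest to [x] and put [d = x - y], so that [d != 0].
    - [d] is tangent to [X] at [y] because [x] lies in [X], and normal to the
      solution set at [y] because [y] is nearest to [x].  Sharpness therefore
      gives [alpha * `|d| <= ip (F y) d] ([sharp_modulus_le]), and
      monotonicity turns this into [alpha * `|d| <= ip (F x) d].
    - [- d] is tangent to [X] at [x].  If [p] is the projection of [- F x] on
      that closed convex cone, then [- F x - p] is polar to the cone, hence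
      [ip (F x) d = ip (- F x) (- d) <= ip p (- d) <= `|p| * `|d|]
      ([ip_le_nearest_cone]).
    So [alpha <= `|p|]: the projections are bounded away from [0] off the
    solution set ([sharp_modulus_le_proj]), and a sequence along which they
    tend to [0] must eventually consist of solutions.

    Both projections exist by the Hilbert projection theorem
    ([nearest_point_exists]). *)

(** * Convex sets and closures in normed modules *)

Lemma convex_setP (R : realType) (V : lmodType R) (A : set V) :
  convex_set A <->
  forall y z (t : R), 0 <= t -> t <= 1 -> A y -> A z ->
    A (t *: y + (1 - t) *: z).
Proof.
split=> [cA y z t t0 t1 Ay Az|cA y z t].
  by have /set_mem := cA y z (Itv01 t0 t1) (mem_set Ay) (mem_set Az).
by move=> /set_mem Ay /set_mem Az; apply/mem_set; apply: cA.
Qed.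

Lemma closure_normP (R : realType) (V : normedModType R) (A : set V) (z : V) :
  closure A z <-> forall e : R, 0 < e -> exists2 a, A a & `|z - a| < e.
Proof.
split=> [clAz e e0|Az B /nbhs_normP[e /= e0 eB]].
  have [|a [Aa za]] := clAz (ball z e); first exact: nbhsx_ballx.
  by exists a => //; move: za; rewrite -ball_normE.
by have [a Aa za] := Az _ e0; exists a; split=> //; apply: eB.
Qed.

Lemma convex_closure (R : realType) (V : normedModType R) (A : set V) :
  convex_set A -> convex_set (closure A).
Proof.
move=> /convex_setP cA; apply/convex_setP => y z t t0 t1.
move=> /closure_normP Ay /closure_normP Az; apply/closure_normP => e e0.
have e20 : 0 < e / 2 by lra.
have [a Aa /ltW ya] := Ay _ e20; have [b Ab /ltW zb] := Az _ e20.
exists (t *: a + (1 - t) *: b); first exact: cA.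
rewrite opprD addrACA -!scalerBr (le_lt_trans (ler_normD _ _))// !normrZ.
have t10 : 0 <= 1 - t by rewrite subr_ge0.
rewrite ger0_norm// ger0_norm//.
by have := ler_wpM2l t0 ya; have := ler_wpM2l t10 zb; lra.
Qed.

(** * Inner products inducing the norm *)

Section inner_product_bilinear.
Context (R : realType) (H : normedModType R) (ip : {dot H for idfun}).

Lemma ipC (u v : H) : ip u v = ip v u.
Proof. by rewrite hermC expr0 mul1r. Qed.

Lemma ipDr (u v w : H) : ip u (v + w) = ip u v + ip u w.
Proof. exact: linearDr. Qed.

Lemma ipNr (u v : H) : ip u (- v) = - ip u v.
Proof. exact: linearNr. Qed.

Lemma ipZr (t : R) (u v : H) : ip u (t *: v) = t * ip u v.
Proof. exact: linearZr_LR. Qed.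

Lemma ipBr (u v w : H) : ip u (v - w) = ip u v - ip u w.
Proof. by rewrite ipDr ipNr. Qed.

Lemma ipNl (u v : H) : ip (- u) v = - ip u v.
Proof. by rewrite ipC ipNr ipC. Qed.

Lemma ipDl (u v w : H) : ip (u + v) w = ip u w + ip v w.
Proof. by rewrite ipC ipDr !(ipC w). Qed.

Lemma ipBl (u v w : H) : ip (u - v) w = ip u w - ip v w.
Proof. by rewrite ipDl ipNl. Qed.

End inner_product_bilinear.

Section inner_product_norm.
Context (R : realType) (H : normedModType R) (ip : {dot H for idfun}).
Hypothesis ipH : induces_norm ip.

Lemma normDE (u v : H) : `|u + v| ^+ 2 = `|u| ^+ 2 + 2 * ip u v + `|v| ^+ 2.
Proof. by rewrite -!ipH ipDl !ipDr (ipC ip v u); ring. Qed.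

Lemma normBE (u v : H) : `|u - v| ^+ 2 = `|u| ^+ 2 - 2 * ip u v + `|v| ^+ 2.
Proof. by rewrite normDE ipNr normrN mulrN. Qed.

(** Cauchy-Schwarz, read off from the triangle inequality by expanding
    [`|u + v| ^+ 2 <= (`|u| + `|v|) ^+ 2]. *)
Lemma ip_le_norm (u v : H) : ip u v <= `|u| * `|v|.
Proof.
have : `|u + v| ^+ 2 <= (`|u| + `|v|) ^+ 2.
  by rewrite lerXn2r ?nnegrE ?addr_ge0// ler_normD.
by rewrite normDE; lra.
Qed.

(** By Cauchy-Schwarz [ip u] is continuous, so a point where it is positive has
    a neighbourhood on which it stays positive. *)
Lemma closure_sub_polar (A : set H) (u : H) :
  polar ip A u -> polar ip (closure A) u.
Proof.
move=> Au z /closure_normP clAz; rewrite leNgt; apply/negP => uz0.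
have u1 : 0 < `|u| + 1 by rewrite ltr_wpDl.
(* The [+ 1] keeps the radius [ip u z / (`|u| + 1)] meaningful when [u = 0]. *)
have [a Aa za] := clAz _ (divr_gt0 uz0 u1).
have := Au _ Aa.
have := ip_le_norm u (z - a); rewrite ipBr.
move: za; rewrite ltr_pdivlMr//.
have : 0 <= `|z - a| by [].
by nra.
Qed.

End inner_product_norm.

(** * Nearest points of closed convex sets *)

(** The almost-nearest points of [C] generate a Cauchy filter: by the
    parallelogram law two points of [C] whose midpoint, also in [C], cannot be
    much closer to [x] than they are, must be close to each other.  The limit of
    that filter is the nearest point. *)
Lemma nearest_point_exists (R : realType) (H : completeNormedModType R)
    (ip : {dot H for idfun}) (ipH : induces_norm ip) (C : set H) (x : H) :
  C !=set0 -> closed C -> convex_set C ->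
  exists p, C p /\ forall y, C y -> `|x - p| <= `|x - y|.
Proof.
move=> [c Cc] Ccl /convex_setP Ccvx.
pose E := [set `|x - y| ^+ 2 | y in C].
have Einf : has_inf E.
  by split; [exists (`|x - c| ^+ 2), c | exists 0 => _ [y _ <-]].
have leE y : C y -> inf E <= `|x - y| ^+ 2.
  by move=> Cy; apply: ge_inf; [exact: Einf.2 | exists y].
pose S (e : R) := [set y | C y /\ `|x - y| ^+ 2 < inf E + e].
pose G := filter_from [set e : R | 0 < e] S.
have GF : ProperFilter G.
  apply: filter_from_proper.
    apply: filter_from_filter; first by exists 1; exact: ltr01.
    move=> i j /= i0 j0; exists (Num.min i j); first by rewrite /= lt_min i0.
    by move=> y [Cy]; rewrite -ltrBlDl lt_min => /andP[yi yj];
      split; split=> //; rewrite -ltrBlDl.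
  move=> e /= e0; have [_ [y Cy <-] ye] := inf_adherent e0 Einf.
  by exists y.
have Gcauchy : cauchy G.
  apply: cauchy_exP => e e0.
  (* If [y] and [z] are within [q + c] of [x] in squared distance, [q] being the
     infimum, the parallelogram law gives [`|y - z| ^+ 2 < 4 * c]. *)
  have e40 : 0 < e ^+ 2 / 4 by rewrite divr_gt0 ?exprn_gt0.
  have [_ [y Cy <-] ye] := inf_adherent e40 Einf.
  exists y, (e ^+ 2 / 4) => // z [Cz ze]; rewrite -ball_normE /=.
  rewrite -(@ltr_pXn2r _ 2) ?nnegrE// ?ltW//.
  have := leE _ (Ccvx y z 2^-1 ltac:(lra) ltac:(lra) Cy Cz).
  have -> : x - (2^-1 *: y + (1 - 2^-1) *: z) =
            2^-1 *: ((x - y) + (x - z)).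
    have -> : 1 - 2^-1 = 2^-1 :> R by lra.
    rewrite -scalerDr addrACA -opprD scalerBr; congr (_ - _).
    by rewrite -mulr2n -[x *+ 2]scaler_nat scalerA mulVf ?scale1r.
  have -> : y - z = (x - z) - (x - y) by rewrite opprB [RHS]addrC subrKA.
  rewrite normrZ exprMn (normDE ipH (x - y)) (normBE ipH (x - z)) ger0_norm ?invr_ge0//.
  by rewrite (ipC ip (x - z)); move: ye ze; lra.
have [p Gp] : exists p : H, G --> p by exists (lim G); exact: cauchy_cvg.
have Cp : C p.
  apply: (@closed_cvg _ _ G GF id C Ccl _ p Gp).
  by exists 1 => [|y [//]]; exact: ltr01.
have fp : `|x - z| ^+ 2 @[z --> G] --> `|x - p| ^+ 2.
  have fn : `|x - z| @[z --> G] --> `|x - p|.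
    by apply: cvg_norm; apply: cvgB => //; exact: cvg_cst.
  exact: (cvgM fn fn).
have lep : `|x - p| ^+ 2 <= inf E.
  apply/ler_addgt0Pr => e e0.
  apply: (@closed_cvg _ _ G GF _ _ (@closed_le R (inf E + e)) _ _ fp).
  by exists e => // y [_ /ltW].
exists p; split=> // y Cy.
by rewrite -(@ler_pXn2r _ 2) ?nnegrE//; apply: (le_trans lep); exact: leE.
Qed.

Section nearest_point.
Context (R : realType) (H : normedModType R) (ip : {dot H for idfun}).
Hypothesis ipH : induces_norm ip.

(** Moving from [p] towards [y] stays in [C] and must not bring the point
    closer to [x], so the derivative of the squared distance at [p] is
    nonnegative. *)
Lemma nearest_point_obtuse (C : set H) (x p : H) : convex_set C -> C p ->
  (forall y, C y -> `|x - p| <= `|x - y|) ->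
  forall y, C y -> ip (x - p) (y - p) <= 0.
Proof.
move=> /convex_setP Ccvx Cp xp y Cy; rewrite leNgt; apply/negP.
set c := ip _ _ => c0.
pose n := `|y - p| ^+ 2.
have n0 : 0 <= n by exact: sqr_ge0.
(* [t] lies in [0, 1] and satisfies [t * n < 2 * c], which makes
   [p + t *: (y - p)] strictly closer to [x] than [p]. *)
pose t := c / (c + n).
have cn0 : 0 < c + n by rewrite ltr_wpDr.
have t0 : 0 < t by rewrite divr_gt0.
have t1 : t <= 1 by rewrite ler_pdivrMr// mul1r lerDl.
have tE : t * (c + n) = c by rewrite divfK// gt_eqF.
have /xp := Ccvx y p t (ltW t0) t1 Cy Cp.
rewrite -(@ler_pXn2r _ 2) ?nnegrE//.
have -> : x - (t *: y + (1 - t) *: p) = (x - p) - t *: (y - p).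
  rewrite scalerBl scale1r scalerBr !opprD !opprK.
  by rewrite -!addrA; congr (_ + _); rewrite addrCA.
rewrite (normBE ipH (x - p)) ipZr normrZ exprMn real_normK ?num_real//.
rewrite -/c -/n.
by nra.
Qed.

(** By Moreau's decomposition [w - p] is orthogonal to [p] and polar to [K],
    so [ip w v <= ip p v]. *)
Lemma ip_le_nearest_cone (K : set H) (w p : H) : convex_set K ->
  (forall t v, 0 <= t -> K v -> K (t *: v)) -> K p ->
  (forall y, K y -> `|w - p| <= `|w - y|) ->
  forall v, K v -> ip w v <= `|p| * `|v|.
Proof.
move=> Kcvx Kcone Kp wp v Kv.
have obt := nearest_point_obtuse Kcvx Kp wp.
(* Comparing [p] with the points [0] and [2 *: p] of its own ray gives
   [ip (w - p) p = 0]. *)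
have := obt _ (Kcone 0 _ (lexx _) Kp).
have := obt _ (Kcone 2 _ (ler0n _ _) Kp).
have := obt _ Kv.
have := ip_le_norm ipH p v.
rewrite !(ipBr, ipBl, ipZr).
by lra.
Qed.

End nearest_point.

(** * Tangent cones *)

Section tangent_cone.
Context (R : realType) (H : normedModType R) (C : set H) (x : H).

Lemma sub_tangent_cone y : C y -> tangent_cone C x (y - x).
Proof.
by move=> Cy; apply: subset_closure; exists 1;
  [exact: ltr01 | exists y => //; rewrite invr1 scale1r].
Qed.

Lemma tangent_coneZ (t : R) v : C x -> 0 <= t ->
  tangent_cone C x v -> tangent_cone C x (t *: v).
Proof.
move=> Cx; rewrite le_eqVlt => /predU1P[<- _|t0 /closure_normP Tv].
  by rewrite scale0r -(subrr x); exact: sub_tangent_cone.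
apply/closure_normP => e e0.
have [_ [l /= l0 [y Cy <-]] ve] := Tv _ (divr_gt0 e0 t0).
exists (t *: (l^-1 *: (y - x))).
  exists (l / t); first exact: divr_gt0.
  by exists y => //; rewrite scalerA invf_div.
by rewrite -scalerBr normrZ gtr0_norm// mulrC -ltr_pdivlMr.
Qed.

(** A combination of [l^-1 *: (y - x)] and [m^-1 *: (z - x)] is again a positive
    multiple of [c - x] for some [c] between [y] and [z]: the total weight
    becomes the multiple and the normalized weights give [c]. *)
Lemma convex_tangent_cone : convex_set C -> convex_set (tangent_cone C x).
Proof.
move=> /convex_setP Ccvx; apply/convex_closure/convex_setP => u v t t0 t1.
move=> [l /= l0 [y Cy <-]] [m /= m0 [z Cz <-]].
pose a := t / l; pose b := (1 - t) / m.
have ab0 : 0 < a + b.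
  rewrite /a /b addf_div ?gt_eqF// divr_gt0 ?mulr_gt0//.
  by have [->|tn0] := eqVneq t 0; nra.
have a0 : 0 <= a by rewrite divr_ge0// ltW.
have b0 : 0 <= b by rewrite divr_ge0 ?subr_ge0// ltW.
exists (a + b)^-1; first by rewrite /= invr_gt0.
exists ((a / (a + b)) *: y + (1 - a / (a + b)) *: z).
  apply: Ccvx => //; first by rewrite divr_ge0 ?(ltW ab0).
  by rewrite ler_pdivrMr// mul1r lerDl.
have -> : 1 - a / (a + b) = b / (a + b) by field; rewrite gt_eqF.
rewrite invrK scalerBr scalerDr !scalerA ![(a + b) * _]mulrC !divfK ?gt_eqF//.
by rewrite !scalerBr scalerDl opprD addrACA.
Qed.

Lemma polar_tangent_cone (ip : {dot H for idfun}) (u : H) :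
  induces_norm ip ->
  (forall y, C y -> ip u (y - x) <= 0) -> polar ip (tangent_cone C x) u.
Proof.
move=> ipH uC; apply: closure_sub_polar => // _ [l /= l0 [y Cy <-]].
by rewrite ipZr pmulr_rle0 ?invr_gt0// uC.
Qed.

End tangent_cone.
Arguments sub_tangent_cone {R H C} x {y} _ _.
Arguments tangent_coneZ {R H C x t v} _ _ _ _.
Arguments polar_tangent_cone {R H C x ip u} _ _ _ _.

(** * Weak sharpness and the projected map *)

Lemma metric_proj_polar (R : realType) (H : normedModType R)
    (ip : {dot H for idfun}) (K : set H) (w : H) :
  induces_norm ip -> K 0 -> polar ip K w -> metric_proj K w = 0.
Proof.
move=> ipH K0 wK; apply: get_unique.
  split=> // y Ky; rewrite -(@ler_pXn2r _ 2) ?nnegrE// subr0 (normBE ipH).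
  by have := wK _ Ky; have := sqr_ge0 `|y|; lra.
move=> p [Kp /(_ _ K0)]; rewrite -(@ler_pXn2r _ 2) ?nnegrE// subr0 (normBE ipH).
have := wK _ Kp => wp pw; apply/eqP; rewrite -normr_eq0 -sqrf_eq0.
by apply/eqP; have := sqr_ge0 `|p|; lra.
Qed.

(** The inclusion of balls defining the modulus, tested at the unit vector in
    the direction of [v]. *)
Lemma sharp_modulus_le (R : realType) (H : normedModType R)
    (ip : {dot H for idfun}) (ipH : induces_norm ip)
    (X : set H) (F : H -> H) (alpha : R) (xs v : H) :
  weakly_sharp_modulus ip X F alpha -> VI_sol ip X F xs ->
  tangent_cone X xs v -> normal_cone ip (VI_sol ip X F) xs v ->
  alpha * `|v| <= ip (F xs) v.
Proof.
move=> [_ sharp] Sxs Tv Nv.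
have [->|v0] := eqVneq v 0; first by rewrite normr0 mulr0 -(scale0r v) ipZr mul0r.
have nv0 : 0 < `|v| by rewrite normr_gt0.
have [|w wpol wE] := sharp _ Sxs (alpha *: (`|v|^-1 *: v)).
  exists (`|v|^-1 *: v) => //; rewrite closed_ballE// /closed_ball_ /=.
  by rewrite sub0r normrN normrZ normfV normr_id mulVf// gt_eqF.
have := wpol v (conj Tv Nv).
have /(congr1 (ip v)) := wE; rewrite ipDr !ipZr ipH.
rewrite (ipC ip v w) (ipC ip v (F xs)) => E.
have -> : alpha * `|v| = ip (F xs) v + ip w v.
  by rewrite E; field; rewrite gt_eqF.
by lra.
Qed.

(** With [y] the solution nearest to [x], the vector [x - y] is a direction to
    which sharpness at [y] applies, while [y - x] is a direction of the cone on
    which [- F x] is projected; monotonicity links the two estimates. *)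
Lemma sharp_modulus_le_proj (R : realType) (H : completeNormedModType R)
    (ip : {dot H for idfun}) (ipH : induces_norm ip)
    (X : set H) (F : H -> H) (alpha : R) (x : H) :
  convex_set X -> monotone_on ip X F -> VI_sol ip X F !=set0 ->
  closed (VI_sol ip X F) -> convex_set (VI_sol ip X F) ->
  weakly_sharp_modulus ip X F alpha -> X x -> ~ VI_sol ip X F x ->
  alpha <= `|metric_proj (tangent_cone X x) (- F x)|.
Proof.
move=> Xcvx Fmono S0 Scl Scvx sharp Xx nSx.
have [y [Sy xy]] := nearest_point_exists ipH x S0 Scl Scvx.
have obt := nearest_point_obtuse ipH Scvx Sy xy.
have d0 : 0 < `|x - y|.
  by rewrite normr_gt0 subr_eq0; apply: contra_notN nSx => /eqP ->.
have := sharp_modulus_le ipH sharp Sy (sub_tangent_cone _ Xx).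
move=> /(_ (polar_tangent_cone ipH obt)).
have := Fmono _ _ Xx Sy.1; rewrite ipBl.
set T := tangent_cone X x.
have TB z : X z -> T (z - x) by exact: sub_tangent_cone.
have Tcl : closed T by exact: closed_closure.
have Tcvx : convex_set T by exact: convex_tangent_cone.
have TZ t v : 0 <= t -> T v -> T (t *: v) by exact: tangent_coneZ.
have T0 : T !=set0 by exists (x - x); exact: TB.
have /getPex := nearest_point_exists ipH (- F x) T0 Tcl Tcvx.
rewrite -/(metric_proj _ _); set p := metric_proj _ _ => -[Tp wp].
have := ip_le_nearest_cone ipH Tcvx TZ Tp wp (TB _ Sy.1).
rewrite -(opprB x y) ipNl ipNr opprK normrN => h1 h2 h3.
by rewrite -(ler_pM2r d0); lra.
Qed.

Unset Implicit Arguments.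

Theorem theorem4p2 (R : realType) (H : completeNormedModType R)
    (ip : {dot H for idfun}) (ipH : induces_norm ip)
    (X : set H) (X0 : X !=set0) (Xcl : closed X) (Xcvx : convex_set X)
    (F : H -> H) (Fmono : monotone_on ip X F)
    (S0 : VI_sol ip X F !=set0) (Scl : closed (VI_sol ip X F))
    (Scvx : convex_set (VI_sol ip X F))
    (Ssharp : exists2 alpha : R, 0 < alpha & weakly_sharp_modulus ip X F alpha)
    (x : nat -> H) (xX : forall k, X (x k)) :
  (\forall k \near \oo, VI_sol ip X F (x k)) <->
  (metric_proj (tangent_cone X (x k)) (- F (x k)) @[k --> \oo] --> (0 : H)).
Proof.
split=> [xS|].
  apply: cvg_near_cst; near=> k.
  have [_ Sk] : VI_sol ip X F (x k) by near: k.
  apply: (metric_proj_polar ipH).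
    by rewrite -(subrr (x k)); apply: sub_tangent_cone.
  by apply: polar_tangent_cone => // y /Sk; rewrite ipNl oppr_le0.
have [alpha a0 sharp] := Ssharp.
move=> /cvgrPdist_lt /(_ _ a0) small; near=> k.
apply: contrapT => nS.
have := sharp_modulus_le_proj ipH Xcvx Fmono S0 Scl Scvx sharp (xX k) nS.
rewrite leNgt => /negP; apply; rewrite -normrN -sub0r.
by near: k.
Unshelve. all: by end_near.
Qed.
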